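(* Let $(\Omega,\mathcal F,P)$ be a probability space, let $K$ be $\mathbb R$ or $\mathbb C$, and let $L^0(\mathcal F,K)$ be the algebra of ($P$-almost sure) equivalence classes of $K$-valued random variables on $(\Omega,\mathcal F,P)$. Let $E$ be a finitely generated unitary $L^0(\mathcal F,K)$-module with the following property: for all $x,y\in E$, if there is a countable measurable partition $\{A_n\}_{n\ge1}$ of $\Omega$ with $\tilde I_{A_n}x=\tilde I_{A_n}y$ for every $n$, then $x=y$. Then $E$ has a quasi-basis. Moreover, if $\{x_1,\dots,x_n\}$ and $\{y_1,\dots,y_m\}$ are two quasi-bases for $E$, then $m=n$ and $i_{x_j}=i_{y_j}$ for $1\le j\le n$.
   Context: For $A\in\mathcal F$, $\tilde I_A\in L^0(\mathcal F,K)$ is the equivalence class of the characteristic function of $A$. The set $\mathcal I=\{\tilde I_A : A\in\mathcal F\}$ is the set of idempotents of $L^0(\mathcal F,K)$, ordered by $\tilde I_A\le\tilde I_B$ iff $\tilde I_A\tilde I_B=\tilde I_A$ (i.e. $P(A\setminus B)=0$); it is a complete lattice with $\tilde I_A\vee\tilde I_B=\tilde I_{A\cup B}$ and $\tilde I_A\wedge\tilde I_B=\tilde I_{A\cap B}$. A countable measurable partition of $\Omega$ is a sequence of pairwise disjoint sets in $\mathcal F$ (possibly empty) with union $\Omega$. Let $\theta$ be the null element of $E$. For $x\in E$, $i_x$ denotes the minimum element of $\{i\in\mathcal I : ix=x\}$ (it exists under the separation property assumed for $E$; equivalently $i_x=1-\bigvee\{i\in\mathcal I : ix=\theta\}$).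 In particular $i_\theta=0$. Quasi-basis: a subset $\{x_1,x_2,\dots,x_n\}$ of $E$ is called a quasi-basis for $E$ if (a) $E=\mathrm{span}_{L^0(\mathcal F,K)}\{x_1,\dots,x_n\}$; (b) $i_{x_1}\ge i_{x_2}\ge\cdots\ge i_{x_n}$; (c) for all $a_1,\dots,a_n\in L^0(\mathcal F,K)$, $\sum_{j=1}^n a_jx_j=\theta$ implies $a_ji_{x_j}=0$ for all $1\le j\le n$.
   Formalization: The claim m = n is proved only for quasi-bases without the null element, since {1} and {1, θ} are both quasi-bases of L⁰; existence gives a quasi-basis without θ (empty if E = {θ}), and i_{x_j} = i_{y_j} is proved for every index j common to both. *)

(* Defs.v *)
From HB Require Import structures.
From mathcomp Require Import all_boot all_order all_algebra.
From mathcomp Require Import all_classical all_reals all_analysis.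
From mathcomp Require Import complex.

Set Implicit Arguments.
Unset Strict Implicit.
Unset Printing Implicit Defensive.

Import Order.TTheory GRing.Theory Num.Theory.
Import numFieldNormedType.Exports.
Local Open Scope classical_set_scope.
Local Open Scope ring_scope.
Local Open Scope quotient_scope.

Variant scalar_kind := RealScalars | ComplexScalars.

Definition scalars (R : realType) (k : scalar_kind) : numFieldType :=
  match k with
  | RealScalars => R
  | ComplexScalars => R[i]
  end.

(* K with its Borel sigma-algebra: on R[i], where the library has no measurable
   structure, as on R, it is the one generated by the open sets of the norm. *)
Definition borel (K : numFieldType) := g_sigma_algebraType (@open K).

HB.instance Definition _ (K : numFieldType) := Measurable.on (borel K).

(* A countable base of the topology makes sums and products of Borel functions
   Borel. *)
Definition countable_base (K : numFieldType) :=
  exists (I : countType) (V : I -> set K), (forall i, open (V i)) /\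
    forall (x : K) A, nbhs x A -> exists2 i, V i x & V i `<=` A.

Section CountableBase.

Lemma countable_base_dense (K : numFieldType) (I : countType) (q : I -> K) :
  (forall e : K, 0 < e -> exists n : nat, n.+1%:R^-1 < e) ->
  (forall (x e : K), 0 < e -> exists i, `|q i - x| < e) ->
  countable_base K.
Proof.
move=> archi dense; exists (I * nat)%type.
exists (fun p => ball (q p.1) (p.2.+1%:R^-1 : K)).
split=> [p|x A]; first by apply: ball_open.
case/nbhs_ballP => e /= e0 eA.
have [n ne] := archi _ (divr_gt0 e0 (@ltr0n K 2)).
have n0 : 0 < n.+1%:R^-1 :> K by rewrite invr_gt0 ltr0n.
have [i iq] := dense x n.+1%:R^-1 n0.
exists (i, n) => //= y; rewrite /ball /= => qy; apply: eA; rewrite /ball /=.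
have -> : x - y = (x - q i) + (q i - y) by rewrite addrA subrK.
rewrite (splitr e) (le_lt_trans (ler_normD _ _))// ltrD//.
  by rewrite distrC (lt_trans iq).
by rewrite (lt_trans qy).
Qed.

Variable R : realType.

Let archiR (e : R) : 0 < e -> exists n : nat, n.+1%:R^-1 < e.
Proof. by move=> /ltr_add_invr[n]; rewrite add0r; exists n. Qed.

Let denseR (x e : R) : 0 < e -> exists r : rat, `|ratr r - x| < e.
Proof.
move=> e0; have /rat_in_itvoo[r] : x - e < x + e.
  by rewrite ltrBlDr -addrA ltrDl addr_gt0.
by rewrite in_itv/= => rx; exists r; rewrite ltr_distl.
Qed.

Lemma countable_base_scalars (k : scalar_kind) : countable_base (scalars R k).
Proof.
case: k => /=; first exact: (@countable_base_dense R rat ratr).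
pose q (p : rat * rat) : R[i] := Complex (ratr p.1) (ratr p.2).
apply: (@countable_base_dense R[i] _ q) => [[a b]|x [a b]].
  rewrite ltcE /= => /andP[/eqP -> a0].
  have [n na] := archiR a0; exists n.
  by rewrite -(rmorph_nat (real_complex R)) -fmorphV ltcR.
rewrite ltcE /= => /andP[/eqP -> a0].
have a20 : 0 < a / 2 by rewrite divr_gt0.
have [r rx] := denseR (complex.Re x) a20.
have [s sx] := denseR (complex.Im x) a20.
exists (r, s); case: x rx sx => u v /= rx sx; rewrite /q /=.
rewrite normc_def ltcR /=.
set c := ratr r - u in rx *; set d := ratr s - v in sx *.
have cd0 : 0 <= `|c| + `|d| by rewrite addr_ge0.
apply: (@le_lt_trans _ _ (`|c| + `|d|)).
  rewrite -[leRHS]ger0_norm// -[leRHS]sqrtr_sqr ler_wsqrtr//.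
  rewrite [leRHS]sqrrD !real_normK ?num_real// addrAC lerDl.
  by rewrite mulrn_wge0// mulr_ge0.
by rewrite (splitr a) ltrD.
Qed.

End CountableBase.

Section RandomVariables.
Context d (Omega : measurableType d) (R : realType) (k : scalar_kind).
Local Notation K := (scalars R k).
Implicit Types f g : {mfun Omega >-> borel K}.

Lemma measurable_borelP (f : Omega -> borel K) :
  (forall U : set K, open U -> measurable (f @^-1` U)) -> measurable_fun setT f.
Proof.
move=> fU; apply: (@measurability _ _ _ (borel K) setT f (@open K) erefl).
by move=> _ [U oU <-]; rewrite setTI; exact: fU.
Qed.

Lemma mfun_open f (U : set K) : open U -> measurable (f @^-1` U).
Proof.
move=> oU; rewrite -[X in measurable X]setTI.
by apply: (measurable_funPT f) => //; exact: sub_sigma_algebra.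
Qed.

Lemma measurable_cst_borel (c : K) :
  measurable_fun setT (cst c : Omega -> borel K).
Proof. exact: measurable_cst. Qed.

Lemma measurable_continuous (h : K -> K) f :
  continuous h -> measurable_fun setT (h \o f : Omega -> borel K).
Proof.
move=> /continuousP ch; apply: measurable_borelP => U oU.
exact: (@mfun_open f (h @^-1` U) (ch _ oU)).
Qed.

Lemma measurable_opp f :
  measurable_fun setT ((fun w => - (f w : K)) : Omega -> borel K).
Proof.
apply: (@measurable_continuous -%R) => x.
exact: opp_continuous.
Qed.

Lemma measurable_continuous2 (h : K * K -> K) f g : continuous h ->
  measurable_fun setT ((fun w => h (f w, g w)) : Omega -> borel K).
Proof.
move=> ch; apply: measurable_borelP => U oU.
have [I [V [oV bV]]] := countable_base_scalars R k.
pose W (p : I * I) : set Omega :=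
  if `[< V p.1 `*` V p.2 `<=` h @^-1` U >]
  then f @^-1` V p.1 `&` g @^-1` V p.2 else set0.
have -> : (fun w => h (f w, g w)) @^-1` U = \bigcup_p W p.
  apply/seteqP; split=> [w Uw|w [p _]]; last first.
    by rewrite /W; case: asboolP => // VU [] *; apply: VU.
  have : nbhs (f w, g w) (h @^-1` U).
    by apply: ch; apply: open_nbhs_nbhs; split.
  case=> -[A B] /= [/bV[i if_ iA] /bV[j jg jB]] AB.
  exists (i, j) => //; rewrite /W asboolT//= => -[x y] /= [xi yj].
  by apply: AB; split; [exact: iA|exact: jB].
apply: countable_bigcupT_measurable => [|p]; first exact: countableP.
by rewrite /W; case: ifP => // _; apply: measurableI; exact: mfun_open.
Qed.

Lemma measurable_add f g :
  measurable_fun setT ((fun w => (f w : K) + g w) : Omega -> borel K).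
Proof.
apply: (@measurable_continuous2 (fun z => z.1 + z.2)) => z.
exact: pseudometric_normed_Zmodule.add_continuous.
Qed.

Lemma measurable_mul f g :
  measurable_fun setT ((fun w => (f w : K) * g w) : Omega -> borel K).
Proof.
apply: (@measurable_continuous2 (fun z => z.1 * z.2)) => z.
exact: mul_continuous.
Qed.

Lemma measurable_indic_borel (A : set Omega) : measurable A ->
  measurable_fun setT (\1_A : Omega -> borel K).
Proof.
move=> mA; apply: measurable_borelP => U oU.
have -> : (\1_A : Omega -> K) @^-1` U =
    (if `[< U 1 >] then A else set0) `|` (if `[< U 0 >] then ~` A else set0).
  apply/seteqP; split=> w; rewrite /= indicE.
    case: (pselect (A w)) => Aw.
      by rewrite mem_set//= => U1; left; rewrite asboolT.
    by rewrite memNset//= => U0; right; rewrite asboolT.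
  case; case: asboolP => // Ui Aw; first by rewrite mem_set.
  by rewrite memNset.
by apply: measurableU; case: ifP => // _; exact: measurableC.
Qed.

End RandomVariables.

Section L0.
Context d (Omega : measurableType d) (R : realType) (P : probability Omega R)
  (k : scalar_kind).
Local Notation K := (scalars R k).
Local Notation RV := {mfun Omega >-> borel K}.

Definition L0 : Type := {mfun_ P, Omega >-> borel K}.

HB.instance Definition _ := Choice.on L0.
HB.instance Definition _ := EqQuotient.on L0.

Definition rv (f : Omega -> borel K) (mf : measurable_fun setT f) : RV :=
  HB.pack f (isMeasurableFun.Build _ _ _ _ f mf).

Definition L0_class (f : RV) : L0 := \pi_L0 f.

Definition L0_zero : L0 := L0_class (rv (@measurable_cst_borel _ Omega R k 0)).
Definition L0_one : L0 := L0_class (rv (@measurable_cst_borel _ Omega R k 1)).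
Definition L0_opp (u : L0) : L0 :=
  L0_class (rv (measurable_opp (repr u))).
Definition L0_add (u v : L0) : L0 :=
  L0_class (rv (measurable_add (repr u) (repr v))).
Definition L0_mul (u v : L0) : L0 :=
  L0_class (rv (measurable_mul (repr u) (repr v))).

Lemma L0_classP (f g : RV) : L0_class f = L0_class g <-> f = g %[ae P].
Proof.
split=> [/eqP|fg]; first by rewrite eqmodE => /asboolP.
by apply/eqP; rewrite eqmodE; apply/asboolP.
Qed.

Lemma L0_reprK (u : L0) : L0_class (repr u) = u.
Proof. exact: reprK. Qed.

Lemma L0_class_repr (f : RV) : repr (L0_class f) = f %[ae P].
Proof. by apply/L0_classP; rewrite L0_reprK. Qed.

Lemma L0_oppE (f : RV) : L0_opp (L0_class f) =
  L0_class (rv (measurable_opp f)).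
Proof.
apply/L0_classP; apply: filterS (L0_class_repr f) => w + _.
by move=> /= ->.
Qed.

Lemma L0_addE (f g : RV) : L0_add (L0_class f) (L0_class g) =
  L0_class (rv (measurable_add f g)).
Proof.
apply/L0_classP; apply: filterS2 (L0_class_repr f) (L0_class_repr g).
by move=> w /= fE gE _; rewrite fE// gE.
Qed.

Lemma L0_mulE (f g : RV) : L0_mul (L0_class f) (L0_class g) =
  L0_class (rv (measurable_mul f g)).
Proof.
apply/L0_classP; apply: filterS2 (L0_class_repr f) (L0_class_repr g).
by move=> w /= fE gE _; rewrite fE// gE.
Qed.

Let L0_ind (Q : L0 -> Prop) : (forall f, Q (L0_class f)) -> forall u, Q u.
Proof. by move=> QL u; rewrite -(L0_reprK u); exact: QL. Qed.

Let L0E := (L0_oppE, L0_addE, L0_mulE).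

Let L0_addA : associative L0_add.
Proof.
elim/L0_ind=> f; elim/L0_ind=> g; elim/L0_ind=> h; rewrite !L0E.
by congr L0_class; apply/mfuneqP => w; exact: (@addrA K).
Qed.

Let L0_addC : commutative L0_add.
Proof.
elim/L0_ind=> f; elim/L0_ind=> g; rewrite !L0E.
by congr L0_class; apply/mfuneqP => w; exact: (@addrC K).
Qed.

Let L0_add0 : left_id L0_zero L0_add.
Proof.
elim/L0_ind=> f; rewrite !L0E.
by congr L0_class; apply/mfuneqP => w; exact: (@add0r K).
Qed.

Let L0_addN : left_inverse L0_zero L0_opp L0_add.
Proof.
elim/L0_ind=> f; rewrite !L0E.
by congr L0_class; apply/mfuneqP => w; exact: (@addNr K).
Qed.

HB.instance Definition _ :=
  GRing.isZmodule.Build L0 L0_addA L0_addC L0_add0 L0_addN.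

Let L0_mulA : associative L0_mul.
Proof.
elim/L0_ind=> f; elim/L0_ind=> g; elim/L0_ind=> h; rewrite !L0E.
by congr L0_class; apply/mfuneqP => w; exact: (@mulrA K).
Qed.

Let L0_mulC : commutative L0_mul.
Proof.
elim/L0_ind=> f; elim/L0_ind=> g; rewrite !L0E.
by congr L0_class; apply/mfuneqP => w; exact: (@mulrC K).
Qed.

Let L0_mul1 : left_id L0_one L0_mul.
Proof.
elim/L0_ind=> f; rewrite !L0E.
by congr L0_class; apply/mfuneqP => w; exact: (@mul1r K).
Qed.

Let L0_mulD : left_distributive L0_mul L0_add.
Proof.
elim/L0_ind=> f; elim/L0_ind=> g; elim/L0_ind=> h; rewrite !L0E.
by congr L0_class; apply/mfuneqP => w; exact: (@mulrDl K).
Qed.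

Let L0_one_neq0 : L0_one != L0_zero.
Proof.
apply/eqP => /L0_classP [N [mN N0 sub]].
suff : P setT = 0%E by rewrite probability_setT => /eqP; rewrite onee_eq0.
apply/eqP; rewrite -measure_le0 -N0 le_measure ?inE// => w _.
by apply: sub => /= /(_ I)/eqP; rewrite oner_eq0.
Qed.

HB.instance Definition _ := GRing.Zmodule_isComNzRing.Build L0
  L0_mulA L0_mulC L0_mul1 L0_mulD L0_one_neq0.

Definition L0_indic (A : set Omega) (mA : measurable A) : L0 :=
  L0_class (rv (@measurable_indic_borel _ Omega R k A mA)).

Definition L0_idem : set L0 :=
  [set i | exists (A : set Omega) (mA : measurable A), i = L0_indic mA].

(* For idempotents: i = class of \1_A and j = class of \1_B satisfy
   idem_le i j iff P (A \ B) = 0. *)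
Definition idem_le (i j : L0) : Prop := i * j = i.

End L0.

Arguments L0 {d Omega R} P k.

Section Modules.
Context d (Omega : measurableType d) (R : realType) (P : probability Omega R)
  (k : scalar_kind) (E : lmodType (L0 P k)).

Definition partition_separated : Prop :=
  forall (x y : E) (A : nat -> set Omega) (mA : forall n, measurable (A n)),
    trivIset setT A -> \bigcup_n A n = setT ->
    (forall n, L0_indic P k (mA n) *: x = L0_indic P k (mA n) *: y) -> x = y.

Definition is_support_idem (x : E) (i : L0 P k) : Prop :=
  [/\ L0_idem i, i *: x = x &
      forall j : L0 P k, L0_idem j -> j *: x = x -> idem_le i j].

(* i_x: there is at most one minimum, and one exists when E is
   partition_separated; the default value 0 is then never used. *)
Definition support_idem (x : E) : L0 P k := xget 0 [set i | is_support_idem x i].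

Definition spans n (x : 'I_n -> E) : Prop :=
  forall y : E, exists a : 'I_n -> L0 P k, y = \sum_(j < n) a j *: x j.

Definition finitely_generated : Prop := exists n (x : 'I_n -> E), spans x.

(* The empty family is allowed, and is the only quasi-basis without null terms
   of the zero module.  A quasi-basis stays one when 0 is appended to it, so
   that only the number of its nonzero elements is determined by E. *)
Definition quasi_basis n (x : 'I_n -> E) : Prop :=
  [/\ spans x,
      forall j l : 'I_n, (j <= l)%N -> idem_le (support_idem (x l)) (support_idem (x j)) &
      forall a : 'I_n -> L0 P k, \sum_(j < n) a j *: x j = 0 ->
        forall j, a j * support_idem (x j) = 0].

End Modules.

Arguments partition_separated {d Omega R P k} E.
Arguments finitely_generated {d Omega R P k} E.

(* Main.v *)
Require Import Defs.
From mathcomp Require Import all_boot all_order all_algebra.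
From mathcomp Require Import all_classical all_reals all_analysis.
From mathcomp Require Import ring.
Import GRing.Theory.
Local Open Scope ring_scope.

(** Write [L] for the algebra of random variables. Both halves of the theorem
    are algebra over a commutative ring, once [L] and [E] are known to supply
    supports.

    Supports. For a finite family [s] and an element [x], there is a smallest
    idempotent [i] such that [(1 - i) *: x] lies in the span of [s]. Indeed the
    events [A] such that [x] lies in that span on [A] are closed under countable
    unions: coefficients glue along a measurable partition because they are
    functions, and the separation property makes the glued combination equal to
    [x]. An event of maximal probability among them exists by exhaustion; [i] is
    the indicator of its complement ([L0_relatively_supported]). The absolute
    support [support_idem x] is the case of an empty [s].

    Existence. Adding generators one at a time and cutting each new one, [x], to
    its support [i] relative to the previous ones (replacing it by [i *: x])
    makes [E] a direct sum of cyclic modules. The supports are then put in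
    decreasing order by insertion sort: if [x] and [y] have supports [i] and
    [j], then [x + (1 - i) *: y] and [i *: y] span the same direct sum and have
    supports [i + j - i * j], the join, and [i * j], the meet
    ([cascade_insert]).

    Uniqueness. Let [e] be the part of [support_idem (x j)] outside
    [support_idem (y j)]. On [e] the elements [x 0, ..., x j] are free, whereas
    [y j] and its successors vanish there, so that [j + 1] free elements are
    combinations of the [j] elements [y 0, ..., y (j - 1)]. Over a nonzero
    commutative ring this is impossible ([tall_matrix_idem_eq0], by the
    Cayley-Hamilton theorem); hence [e = 0]. When [j] is past the end of the
    family [y], the same argument gives [x j = 0], whence the equality of the
    lengths. *)

(** * Families spanning a direct sum of cyclic modules with ordered supports *)

Section Span.
Set Implicit Arguments. Unset Strict Implicit.
Context (L : comNzRingType) (E : lmodType L).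
Implicit Types (x y z : E) (s : seq E) (a : L).

Fixpoint in_span s y : Prop :=
  if s is x :: s' then exists a, in_span s' (y - a *: x) else y = 0.

Lemma span0 s : in_span s 0.
Proof. by elim: s => //= x s IH; exists 0; rewrite scale0r subr0. Qed.

Lemma spanD s y z : in_span s y -> in_span s z -> in_span s (y + z).
Proof.
elim: s y z => /= [y z -> ->|x s IH y z [a ya] [b zb]]; first by rewrite addr0.
by exists (a + b); rewrite scalerDl opprD addrACA; exact: IH.
Qed.

Lemma spanZ s a y : in_span s y -> in_span s (a *: y).
Proof.
elim: s y => /= [y ->|x s IH y [b yb]]; first by rewrite scaler0.
by exists (a * b); rewrite -scalerA -scalerBr; exact: IH.
Qed.

Lemma spanN s y : in_span s y -> in_span s (- y).
Proof. by move=> sy; rewrite -scaleN1r; exact: spanZ. Qed.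

Lemma spanB s y z : in_span s y -> in_span s z -> in_span s (y - z).
Proof. by move=> sy sz; apply: spanD => //; exact: spanN. Qed.

Lemma span_head x s : in_span (x :: s) x.
Proof. by exists 1; rewrite scale1r subrr; exact: span0. Qed.

Lemma span_tail x s y : in_span s y -> in_span (x :: s) y.
Proof. by exists 0; rewrite scale0r subr0. Qed.

Lemma span_mem s y : y \in s -> in_span s y.
Proof.
elim: s => //= x s IH; rewrite inE => /predU1P[->|/IH]; first exact: span_head.
exact: span_tail.
Qed.

Lemma span_cons x s t : in_span t x -> (forall y, in_span s y -> in_span t y) ->
  forall y, in_span (x :: s) y -> in_span t y.
Proof.
move=> tx st y [a /st ty]; rewrite -[y](subrK (a *: x)).
by apply: spanD => //; exact: spanZ.
Qed.

Lemma span_sum s y : in_span s y ->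
  exists a : 'I_(size s) -> L, y = \sum_(j < size s) a j *: nth 0 s j.
Proof.
elim: s y => /= [y ->|x s IH y [a /IH[b yb]]].
  by exists (fun=> 0); rewrite big_ord0.
exists (fun j => if unlift ord0 j is Some l then b l else a).
rewrite big_ord_recl unlift_none /= -[LHS](subrK (a *: x)) addrC; congr (_ + _).
by rewrite yb; apply: eq_bigr => l _; rewrite liftK.
Qed.

(** Since the annihilator of an element determines its support, this says that
    the support of [x] is above that of every element of the span of [s]. *)
Definition dominates x s := forall a y, a *: x = 0 -> in_span s y -> a *: y = 0.

(** Independence and decreasing supports of nonzero elements, stated through
    annihilators and triangularly, each element against the span of its
    successors; that is what makes induction on [s] go through. *)
Fixpoint cascade s : Prop :=
  if s is x :: s' then
    [/\ x <> 0, forall a, in_span s' (a *: x) -> a *: x = 0,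
        dominates x s' & cascade s']
  else True.

Lemma cascade_direct s (a : nat -> L) : cascade s ->
  \sum_(j < size s) a j *: nth 0 s j = 0 ->
  forall j, (j < size s)%N -> a j *: nth 0 s j = 0.
Proof.
elim: s a => //= x s IH a [_ dir _ cas]; rewrite big_ord_recl /= => sum0.
have ax0 : a 0%N *: x = 0.
  apply: dir; rewrite -[_ *: x](addrK (\sum_(j < size s) a j.+1 *: nth 0 s j)).
  rewrite sum0 add0r; apply: spanN; apply: big_ind => [||l _].
  - exact: span0.
  - by move=> y z; exact: spanD.
  - by apply: spanZ; apply: span_mem; rewrite mem_nth.
move: sum0; rewrite ax0 add0r => sum0 [|j] //= js.
exact: (IH (fun j => a j.+1)).
Qed.

Lemma cascade_dominates s j l a : cascade s -> (j <= l < size s)%N ->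
  a *: nth 0 s j = 0 -> a *: nth 0 s l = 0.
Proof.
elim: s j l => [|x s IH] [|j] [|l] //= [_ _ dom cas]; rewrite ltnS => ls ax0.
  by apply: (dom a) => //; apply: span_mem; rewrite mem_nth.
exact: (IH j).
Qed.

Lemma cascade_neq0 s j : cascade s -> (j < size s)%N -> nth 0 s j <> 0.
Proof. by elim: s j => [|x s IH] [|j] //= [x0 _ _ /IH]; exact. Qed.

(** The idempotent [i] is the support of the image of [x] in the quotient of
    [E] by the span of [s]. *)
Definition relatively_supported := forall s x, exists i : L,
  [/\ i * i = i, in_span s (x - i *: x) &
      forall a, in_span s (a *: x) -> a * i = 0].

Lemma annihilator_idem x : relatively_supported ->
  exists i : L, [/\ i * i = i, i *: x = x & forall a, a *: x = 0 -> a * i = 0].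
Proof.
move=> /(_ [::] x)[i [ii ix ann]]; exists i; split=> //.
by move/eqP: ix; rewrite subr_eq0 => /eqP.
Qed.

(** One step of insertion sort on supports. With [i] the support of [x] and [y]
    the head of the family, [h = x + (1 - i) *: y] is put at the head, and
    [i *: y] is inserted into the rest. The pair is recovered by [x = i *: h]
    and [(1 - i) *: y = (1 - i) *: h]. Since [h] is a sum of components of a
    direct sum, what kills [h] kills [x] and [(1 - i) *: y], hence also [y], so
    that [h] dominates the rest. *)
Lemma cascade_insert s x : relatively_supported -> cascade s ->
    (forall a, in_span s (a *: x) -> a *: x = 0) ->
  exists t, cascade t /\ forall y, in_span t y <-> in_span (x :: s) y.
Proof.
move=> supp; elim: s x => [|y s IH] x.
  move=> _ _; have [->|/eqP x0] := eqVneq x 0.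
    exists [::]; split=> //= y; split=> [->|[a]]; last by rewrite scaler0 subr0.
    by exists 0; rewrite scaler0 subr0.
  by exists [:: x]; split=> //; split=> // a y _ ->; rewrite scaler0.
move=> [y0 diry domy cas] dirx.
have [i [ii ix ann]] := annihilator_idem x supp.
pose h := x + (1 - i) *: y.
have diriy a : in_span s (a *: (i *: y)) -> a *: (i *: y) = 0.
  by rewrite scalerA; exact: diry.
have [t [cast tE]] := IH (i *: y) cas diriy.
have iys z : in_span (i *: y :: s) z -> in_span (y :: s) z.
  apply: span_cons; first by apply: spanZ; exact: span_head.
  by move=> w; exact: span_tail.
have split_h a : in_span (i *: y :: s) (a *: h) ->
    a *: x = 0 /\ a *: ((1 - i) *: y) = 0.
  move=> ah; have ax0 : a *: x = 0.
    apply: dirx; rewrite -[_ *: x](addrK (a *: ((1 - i) *: y))) -scalerDr.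
    apply: (@spanB (y :: s)); first exact: iys.
    by rewrite scalerA; apply: spanZ; exact: span_head.
  (* Multiplying by [1 - i] kills the contribution of [i *: y]. *)
  split=> //; move: ah; rewrite scalerDr ax0 add0r => -[b /(@spanZ _ (1 - i) _)].
  rewrite scalerBr !scalerA => sy; apply: diry; move: sy.
  have -> : (1 - i) * a * (1 - i) = a * (1 - i) + a * (i * i - i) by ring.
  have -> : (1 - i) * (b * i) = b * (i - i * i) by ring.
  by rewrite ii !subrr !mulr0 scale0r subr0 addr0.
have dom_hy a : a *: h = 0 -> a *: y = 0.
  move=> ah0; have [|ax0 ay0] := split_h a; first by rewrite ah0; exact: span0.
  by rewrite -[y](subrK (i *: y)) -[X in X - _]scale1r -scalerBl scalerDr ay0
    scalerA ann// scale0r addr0.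
exists (h :: t); split.
  split=> //.
  - move=> h0; apply: y0; rewrite -[y]scale1r; apply: dom_hy.
    by rewrite h0 scaler0.
  - by move=> a /tE/split_h[ax0 ay0]; rewrite scalerDr ax0 ay0 addr0.
  - move=> a z /dom_hy ay0 /tE/iys[b zb].
    rewrite -[z](subrK (b *: y)) scalerDr scalerA mulrC -scalerA ay0 scaler0.
    by rewrite addr0; exact: (domy a).
move=> z; split.
- apply: span_cons => [|w /tE/iys]; last exact: span_tail.
  apply: spanD; first exact: span_head.
  by apply: spanZ; apply: span_tail; exact: span_head.
- have th : in_span (h :: t) h by exact: span_head.
  have tiy : in_span (h :: t) (i *: y).
    by apply: span_tail; apply/tE; exact: span_head.
  have hE : i *: h = x /\ (1 - i) *: h = (1 - i) *: y.
    rewrite !scalerDr !scalerA mulrBr mulr1 ii subrr scale0r addr0 ix.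
    split=> //; rewrite scalerBl scale1r ix subrr add0r.
    by rewrite mulrBr mulr1 mulrBl mul1r ii subrr subr0.
  case: hE => hx hy; apply: span_cons; first by rewrite -hx; exact: spanZ.
  apply: span_cons => [|w sw].
    rewrite -[y](subrK (i *: y)) -[X in X - _]scale1r -scalerBl -hy.
    by apply: spanD => //; exact: spanZ.
  by apply: span_tail; apply/tE; exact: span_tail.
Qed.

(** Cutting [x] to its support modulo the family [t] already built makes the
    sum direct, and leaves the span unchanged because the part of [x] cut off
    lies in the span of [t]. *)
Lemma exists_cascade s : relatively_supported ->
  exists t, cascade t /\ forall y, in_span s y -> in_span t y.
Proof.
move=> supp; elim: s => [|x s [t [cast tE]]]; first by exists [::].
have [i [ii ix ann]] := supp t x.
have [|u [casu uE]] := @cascade_insert t (i *: x) supp cast.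
  by move=> a; rewrite scalerA => /ann; rewrite -mulrA ii => ->; rewrite scale0r.
exists u; split=> // y sy; apply/uE; move: y sy; apply: span_cons.
  rewrite -[X in in_span _ X](subrK (i *: x)).
  by apply: spanD; [exact: span_tail|exact: span_head].
by move=> y /tE; exact: span_tail.
Qed.

End Span.

(** * More free elements than generators *)

(** On [e], the first [n] columns of [A] define an injective map from rows of
    length [n + 1] to rows of length [n]; this forces [e = 0]. Padding with a
    zero column turns the map into a square matrix [B]. If a monic polynomial
    [p = q * 'X + c] satisfies [e *: p(B) = 0], the lower right entry gives
    [e * c = 0], as the last column of any multiple of [B] vanishes; then
    [e *: (q(B) * B) = 0], and [e *: q(B) = 0] by injectivity. Starting from the
    characteristic polynomial one reaches the polynomial [1], that is,
    [e = 0]. *)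
Lemma tall_matrix_idem_eq0 (L : comNzRingType) n m (A : 'M[L]_(n.+1, m)) (e : L) :
    e * e = e ->
    (forall c : 'rV_n.+1, (forall l : 'I_m, (l < n)%N -> (c *m A) 0 l = 0) ->
      e *: c = 0) ->
  e = 0.
Proof.
move=> ee kerA; pose B : 'M[L]_n.+1 := A *m pid_mx n.
have Bmax (M : 'M[L]_n.+1) : (M * B) ord_max ord_max = 0.
  rewrite -[M * B]/(M *m B) mulmxA mxE big1// => l _.
  rewrite [X in _ * X]mxE /= andbC.
  by case: eqP => [->|_]; rewrite ?ltnn ?andbF ?mulr0.
have kerB (M : 'M[L]_n.+1) : e *: (M * B) = 0 -> e *: M = 0.
  move=> eMB; apply/row_matrixP => r; rewrite row0 -ee -scalerA linearZ.
  rewrite linearZ/=; apply: kerA => l ln.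
  have /matrixP/(_ r (widen_ord (leqnSn n) (Ordinal ln))) := eMB.
  rewrite scalemxAl mulmxA -linearZ/= -row_mul.
  rewrite [in X in X -> _]mxE [X in _ = X -> _]mxE.
  rewrite (bigD1 l)//= big1 => [|p pl].
    by rewrite [X in _ * X]mxE /= eqxx ln mulr1 addr0 => H; rewrite [LHS]mxE H.
  by rewrite [X in _ * X]mxE /= (negPf (pl : nat_of_ord p != l)) mulr0.
suff kill p : p \is monic -> e *: horner_mx B p = 0 -> e = 0.
  by apply: (kill _ (char_poly_monic B)); rewrite Cayley_Hamilton scaler0.
elim/poly_ind: p => [|q c IH]; first by rewrite monicE lead_coef0 eq_sym oner_eq0.
have [->|q0] := eqVneq q 0.
  rewrite mul0r add0r monicE lead_coefC => /eqP->.
  by rewrite rmorph1 => /matrixP/(_ 0 0); rewrite !mxE eqxx mulr1.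
move=> mon; rewrite rmorphD rmorphM /= horner_mx_X horner_mx_C => eq0.
have ec : e * c = 0.
  have /matrixP/(_ ord_max ord_max) := eq0.
  by rewrite scalerDr mxE [X in X + _]mxE Bmax !mxE eqxx mulr0 add0r.
apply: IH.
  move: mon; rewrite !monicE lead_coefDl ?lead_coefMX//.
  by rewrite size_mulX// (leq_ltn_trans (size_polyC_leq1 _))// ltnS size_poly_gt0.
apply: kerB; move: eq0; rewrite scalerDr -[e *: c%:M]/(e *: (c%:M : 'M[L]_n.+1)).
by rewrite -scalemx1 scalerA ec scale0r addr0.
Qed.

(** * Random variables: quasi-inverses, gluing, exhaustion *)

Section L0Facts.
Set Implicit Arguments. Unset Strict Implicit.
Import Order.TTheory Num.Theory numFieldNormedType.Exports.
Local Open Scope classical_set_scope.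
Context (d : measure_display) (Omega : measurableType d) (R : realType)
  (P : probability Omega R) (k : scalar_kind).
Local Notation K := (scalars R k).
Local Notation RV := {mfun Omega >-> borel K}.
Local Notation L := (L0 P k).
Local Notation "\1[ mA ]" := (L0_indic P k mA) (at level 0, format "\1[ mA ]").
Implicit Types (A B : set Omega).

Lemma L0_classM (f g h : RV) :
  (forall w, (f w : K) * g w = h w) ->
  L0_class P f * L0_class P g = L0_class P h.
Proof.
move=> fgh; rewrite [LHS]L0_mulE; congr L0_class.
by apply/mfuneqP => w; exact: fgh.
Qed.

Lemma L0_indicM A B (mA : measurable A) (mB : measurable B) :
  \1[mA] * \1[mB] = \1[measurableI _ _ mA mB].
Proof.
by apply: L0_classM => w /=; rewrite !indicE in_setI -natrM mulnb.
Qed.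

Lemma L0_indic_subset A B (mA : measurable A) (mB : measurable B) :
  A `<=` B -> \1[mA] * \1[mB] = \1[mA].
Proof.
move=> AB; rewrite L0_indicM.
by congr L0_class; apply/mfuneqP => w; rewrite /= setIidl.
Qed.

Lemma L0_indicC A (mA : measurable A) : 1 - \1[mA] = \1[measurableC mA].
Proof.
apply/eqP; rewrite subr_eq; apply/eqP; rewrite [RHS]L0_addE.
rewrite -[LHS]/(L0_one P k) /L0_one; congr L0_class.
apply/mfuneqP => w; rewrite /= !indicE in_setC.
by case: (w \in A); rewrite ?addr0 ?add0r.
Qed.

Lemma L0_indic_idem A (mA : measurable A) : \1[mA] * \1[mA] = \1[mA].
Proof. exact: L0_indic_subset. Qed.

Lemma L0_indic_null A (mA : measurable A) : P A = 0%E -> \1[mA] = 0.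
Proof.
move=> PA0; rewrite -[RHS]/(L0_zero P k); apply/L0_classP.
exists A; split=> // w /= nA; apply: contrapT => nAw; apply: nA => _.
by rewrite /= indicE memNset.
Qed.

Lemma open_neq0 : open (~` [set 0] : set K).
Proof.
rewrite openC; apply: accessible_closed_set1; apply: hausdorff_accessible.
exact: norm_hausdorff.
Qed.

(** Inversion is continuous away from [0], and [0] is sent to [0]. *)
Lemma measurable_inv (f : RV) :
  measurable_fun setT ((fun w => (f w : K)^-1) : Omega -> borel K).
Proof.
apply: measurable_borelP => U oU.
have -> : (fun w => (f w : K)^-1) @^-1` U =
    f @^-1` (GRing.inv @^-1` U `&` ~` [set 0]) `|`
    (if `[< U 0 >] then ~` (f @^-1` (~` [set 0])) else set0).
  apply/seteqP; split=> w /=.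
    have [f0|f0 Uf] := eqVneq (f w : K) 0; last by left; split=> //; apply/eqP.
    by rewrite f0 invr0 => U0; right; rewrite asboolT//= f0; apply.
  case=> [[]//|]; case: asboolP => //= U0.
  by move=> /contrapT ->; rewrite invr0.
have o0 := open_neq0.
apply: measurableU; last first.
  by case: ifP => // _; apply: measurableC; exact: mfun_open.
apply: mfun_open; rewrite openE => x [/= Ux x0].
apply: filterI; last by apply: open_nbhs_nbhs.
by apply: inv_continuous; [exact/eqP|exact: open_nbhs_nbhs].
Qed.

(** [L] is a von Neumann regular ring; [A] is the event that [a] is nonzero. It
    reduces questions on annihilators to indicators of events. *)
Lemma L0_quasi_inverse (a : L) :
  exists b A (mA : measurable A), b * a = \1[mA] /\ a * \1[mA] = a.
Proof.
have o0 := open_neq0.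
pose r := repr a; have aE : L0_class P r = a by exact: L0_reprK.
exists (L0_class P (rv (measurable_inv r))).
exists (r @^-1` (~` [set 0])), (mfun_open r o0).
rewrite -aE; split; apply: L0_classM => w /=; rewrite indicE.
  have [r0|r0] := eqVneq (r w : K) 0.
    by rewrite r0 mulr0 memNset//= r0; apply.
  by rewrite mulVf// mem_set//=; apply/eqP.
have [r0|r0] := eqVneq (r w : K) 0; first by rewrite r0 mul0r.
by rewrite mem_set ?mulr1//=; apply/eqP.
Qed.

Lemma idempotent_L0_idem (i : L) : i * i = i -> L0_idem i.
Proof.
move=> ii; have [b [A [mA [ba aA]]]] := L0_quasi_inverse i.
by exists A, mA; rewrite -ba -[in RHS]ii mulrA ba mulrC.
Qed.

Lemma L0_glue (A : nat -> set Omega) (mA : forall n, measurable (A n))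
    (u : nat -> L) : trivIset setT A -> \bigcup_n A n = setT ->
  exists v : L, forall n, \1[mA n] * v = \1[mA n] * u n.
Proof.
move=> tA cA; have /choice[N AN] : forall w, exists n, A n w.
  by move=> w; have : setT w by []; rewrite -cA => -[n _]; exists n.
have NE n w : A n w -> N w = n.
  by move=> Aw; apply: (tA (N w) n) => //; exists w.
have mf : measurable_fun setT ((fun w => repr (u (N w)) w) : Omega -> borel K).
  apply: measurable_borelP => U oU.
  have -> : (fun w => repr (u (N w)) w) @^-1` U =
      \bigcup_n (A n `&` repr (u n) @^-1` U).
    apply/seteqP; split=> [w Uw|w [n _ [/NE <-]]//].
    by exists (N w) => //; split=> //; exact: AN.
  by apply: bigcupT_measurable => n; apply: measurableI => //; exact: mfun_open.
exists (L0_class P (rv mf)) => n.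
rewrite -[u n]L0_reprK [LHS]L0_mulE [RHS]L0_mulE; congr L0_class.
apply/mfuneqP => w /=; rewrite indicE.
have [Aw|nAw] := pselect (A n w); first by rewrite (NE _ _ Aw).
by rewrite memNset// !mul0r.
Qed.

Section Separated.
Context (E : lmodType L) (sepE : partition_separated E).
Implicit Types (x y z : E) (s : seq E).

(** Combinations of a fixed finite family glue because their coefficients do;
    this is how finite generation makes up for the absence of a gluing axiom on
    [E]. *)
Lemma span_glue s (A : nat -> set Omega) (mA : forall n, measurable (A n))
    (z : nat -> E) : trivIset setT A -> \bigcup_n A n = setT ->
    (forall n, in_span s (z n)) ->
  exists2 y, in_span s y & forall n, \1[mA n] *: y = \1[mA n] *: z n.
Proof.
move=> tA cA; elim: s z => [|x s IH] z /=.
  by move=> z0; exists 0 => // n; rewrite z0.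
move=> /choice[a /IH[y sy yE]]; have [b bE] := L0_glue mA a tA cA.
exists (y + b *: x); first by exists b; rewrite addrK.
by move=> n; rewrite scalerDr yE scalerA bE -scalerA -scalerDr subrK.
Qed.

(** Gluing produces an element [z] of the span which agrees with [y] locally;
    separation identifies the two. *)
Lemma span_local s y (B : nat -> set Omega) (mB : forall n, measurable (B n)) :
    \bigcup_n B n = setT -> (forall n, in_span s (\1[mB n] *: y)) ->
  in_span s y.
Proof.
move=> cB sB; have mD := seqDU_measurable mB.
have tD := @trivIset_seqDU _ B.
have cD : \bigcup_n seqDU B n = setT by rewrite -seqDU_bigcup_eq.
have [z sz zE] := span_glue mD tD cD sB.
suff -> : y = z by [].
apply: (@sepE _ _ _ mD tD cD) => n.
by rewrite zE scalerA L0_indic_subset//; exact: subset_seqDU.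
Qed.

Lemma span_bigcup s y (A : nat -> set Omega) (mA : forall n, measurable (A n))
    (mU : measurable (\bigcup_n A n)) :
    (forall n, in_span s (\1[mA n] *: y)) -> in_span s (\1[mU] *: y).
Proof.
move=> sA.
pose B n := if n is n'.+1 then A n' else ~` (\bigcup_n A n).
have mB n : measurable (B n) by case: n => [|n] //=; exact: measurableC.
apply: (@span_local _ _ B mB).
  apply/seteqP; split=> // w _.
  have [[n _ Aw]|nAw] := pselect ((\bigcup_n A n) w).
    by exists n.+1.
  by exists 0%N.
case=> [|n]; rewrite scalerA.
  rewrite L0_indicM L0_indic_null; first by rewrite scale0r; exact: span0.
  by rewrite setICl measure0.
rewrite L0_indic_subset; last by move=> w Aw; exists n.
by rewrite (Prop_irrelevance (mB n.+1) (mA n)); exact: sA.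
Qed.

Lemma L0_relatively_supported : relatively_supported E.
Proof.
move=> s x; pose F := [set A | exists mA : measurable A, in_span s (\1[mA] *: x)].
pose V := [set fine (P A) | A in F].
have F0 : F set0.
  by exists measurable0; rewrite L0_indic_null ?measure0// scale0r; exact: span0.
have supV : has_sup V.
  split; first by exists (fine (P set0)), set0.
  exists 1 => _ [A [mA _] <-].
  by rewrite -lee_fin fineK ?fin_num_measure// probability_le1.
have /choice[A FA] : forall n, exists A, F A /\ sup V - n.+1%:R^-1 < fine (P A).
  move=> n; have n0 : 0 < n.+1%:R^-1 :> R by rewrite invr_gt0 ltr0n.
  by have [_ [A FA <-] lt] := sup_adherent n0 supV; exists A.
have mA n : measurable (A n) by case: (FA n) => -[].
have mU : measurable (\bigcup_n A n) by exact: bigcupT_measurable.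
have sU : in_span s (\1[mU] *: x).
  apply: (@span_bigcup _ _ _ mA) => n; case: (FA n) => -[m sm] _.
  by rewrite (Prop_irrelevance (mA n) m).
have supU : sup V <= fine (P (\bigcup_n A n)).
  apply/ler_addgt0Pl => e /ltr_add_invr[n]; rewrite add0r => ne.
  rewrite -lerBlDl; apply: ltW; apply: lt_le_trans (_ : fine (P (A n)) <= _).
    by apply: le_lt_trans (FA n).2; rewrite lerB// ltW.
  apply: fine_le; rewrite ?fin_num_measure//.
  by apply: le_measure; rewrite ?inE// => w; exists n.
(* The union [U] of a maximizing sequence of events has maximal probability, so
   that any event on which [x] is in the span is contained in [U] up to a null
   set. *)
exists (1 - \1[mU]); split.
- by rewrite L0_indicC L0_indic_idem.
- by rewrite scalerBl scale1r opprB addrCA subrr addr0.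
move=> a sax; have [b [B [mB [ba aB]]]] := L0_quasi_inverse a.
(* Reduce to the indicator of the event [B] that [a] is nonzero. *)
suff BU0 : \1[mB] * (1 - \1[mU]) = 0 by rewrite -aB -mulrA BU0 mulr0.
have mUB : measurable (\bigcup_n A n `|` B) by exact: measurableU.
have FUB : F (\bigcup_n A n `|` B).
  exists mUB; have -> : \1[mUB] = \1[mU] + (1 - \1[mU]) * \1[mB].
    rewrite L0_indicC L0_indicM.
    rewrite [RHS]L0_addE; congr L0_class; apply/mfuneqP => w /=.
    rewrite !indicE in_setU in_setI in_setC.
    by case: (w \in \bigcup_n _); case: (w \in B); rewrite ?addr0 ?add0r.
  rewrite scalerDl -ba mulrA -[(_ * a) *: x]scalerA.
  by apply: spanD => //; exact: spanZ.
rewrite L0_indicC L0_indicM.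
apply: L0_indic_null; rewrite -setDE.
have -> : B `\` \bigcup_n A n = (\bigcup_n A n `|` B) `\` \bigcup_n A n.
  by rewrite setDUl setDv set0U.
apply/eqP; rewrite -measure_le0 measureD ?setUK//; last first.
  by rewrite (le_lt_trans (probability_le1 _ mUB)) ?ltry.
rewrite leeBlDr ?fin_num_measure// add0r -[leLHS]fineK ?fin_num_measure//.
rewrite -[leRHS]fineK ?fin_num_measure// lee_fin (le_trans _ supU)//.
by apply: sup_ubound => //; [exact: (supV.2)|exists (\bigcup_n A n `|` B)].
Qed.

End Separated.
End L0Facts.

(** * Existence and uniqueness of quasi-bases *)

Section QuasiBases.
Set Implicit Arguments. Unset Strict Implicit.
Context (d : measure_display) (Omega : measurableType d) (R : realType)
  (P : probability Omega R) (k : scalar_kind) (E : lmodType (L0 P k))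
  (sepE : partition_separated E).
Local Notation L := (L0 P k).
Implicit Types (x y : E).

Lemma idem_le_compl (i j : L) : (1 - j) * i = 0 -> idem_le i j.
Proof.
by move/eqP; rewrite mulrBl mul1r subr_eq0 mulrC eq_sym => /eqP.
Qed.

Lemma support_idem_spec x : is_support_idem x (support_idem x) /\
  forall a, a *: x = 0 <-> a * support_idem x = 0.
Proof.
have [i [ii ix ann]] := annihilator_idem x (L0_relatively_supported sepE).
have supp_i : is_support_idem x i.
  split=> // [|j _ jx]; first exact: idempotent_L0_idem.
  by apply: idem_le_compl; rewrite ann// scalerBl scale1r jx subrr.
have supp : is_support_idem x (support_idem x) by apply: xgetPex; exists i.
split=> // a; have [_ sx min] := supp; split=> [/ann ai0|as0].
  by rewrite -(min i _ ix) 1?mulrCA ?ai0 ?mulr0//; case: supp_i.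
by rewrite -sx scalerA as0 scale0r.
Qed.

Lemma support_idem_fix x : support_idem x *: x = x.
Proof. by have [[]] := support_idem_spec x. Qed.

Lemma support_idem_ann x a : a *: x = 0 <-> a * support_idem x = 0.
Proof. by have [_] := support_idem_spec x. Qed.

Lemma support_idemM x : support_idem x * support_idem x = support_idem x.
Proof.
have [[si _ min] _] := support_idem_spec x.
by apply: min => //; exact: support_idem_fix.
Qed.

Lemma cascade_quasi_basis (s : seq E) : cascade s ->
  (forall y, in_span s y) ->
  quasi_basis (fun j : 'I_(size s) => nth 0 s j).
Proof.
move=> cas gen; split=> [y|j l jl|a sum0 j].
- by apply: span_sum; exact: gen.
- apply/idem_le_compl/support_idem_ann.
  apply: (@cascade_dominates _ _ s j) => //; first by rewrite jl /=.
  by rewrite scalerBl scale1r support_idem_fix subrr.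
- apply/support_idem_ann.
  pose b (q : nat) := if insub q is Some r then a r else 0.
  have bE (q : 'I_(size s)) : b q = a q.
    by rewrite /b insubT //= => lt; congr a; exact: val_inj.
  rewrite -bE; apply: (@cascade_direct _ _ s b) => //.
  by rewrite -[RHS]sum0; apply: eq_bigr => q _; rewrite bE.
Qed.

(** On [e], which lies below the supports of [x 0], ..., [x j], these [j + 1]
    elements are free, but they are combinations of the at most [j] elements
    [y l] with [l < j]. The index [j] may exceed [m]. *)
Lemma few_generators_idem_eq0 n m (x : 'I_n -> E) (y : 'I_m -> E) (j : 'I_n) e :
    quasi_basis x -> spans y -> e * e = e ->
    idem_le e (support_idem (x j)) ->
    (forall l : 'I_m, (j <= l)%N -> e *: y l = 0) ->
  e = 0.
Proof.
move=> [_ dec indep] spy ee ej ey; have jn : (j < n)%N by [].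
have /choice[a aE] : forall p : 'I_j.+1, exists a : 'I_m -> L,
  x (widen_ord jn p) = \sum_l a l *: y l by move=> p; exact: spy.
apply: (@tall_matrix_idem_eq0 _ j m (\matrix_(p, l) a p l)) => // c cA0.
pose b (q : 'I_n) : L := if (q < j.+1)%N then e * c 0 (inord q) else 0.
have bE (p : 'I_j.+1) : b (widen_ord jn p) = e * c 0 p.
  by rewrite /b /= ltn_ord inord_val.
have sum0 : \sum_(q < n) b q *: x q = 0.
  rewrite (bigID (fun q : 'I_n => (q < j.+1)%N)) /= addrC big1 ?add0r; last first.
    by move=> q /negPf qj; rewrite /b qj scale0r.
  rewrite (big_ord_narrow jn).
  under eq_bigr => p _ do rewrite bE aE scaler_sumr.
  rewrite exchange_big big1 //= => l _.
  have [lj|jl] := ltnP l j; last first.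
    by apply: big1 => p _; rewrite scalerA -mulrA mulrC -scalerA ey// scaler0.
  rewrite -[RHS](scale0r (y l)) -[X in X *: _](mulr0 e) -(cA0 l lj) mxE.
  rewrite mulr_sumr scaler_suml; apply: eq_bigr => p _.
  by rewrite mxE scalerA mulrA.
apply/rowP => p; rewrite mxE [RHS]mxE -bE.
have := indep b sum0 (widen_ord jn p); rewrite bE => ecp.
have pj : (widen_ord jn p <= j)%N by rewrite -ltnS /=.
rewrite -ej -(dec _ _ pj) mulrA mulrC.
set i := support_idem _ in ecp *; set i' := support_idem _.
by rewrite -[RHS](mulr0 i') -[X in i' * X]ecp; ring.
Qed.

Lemma quasi_basis_support_le n m (x : 'I_n -> E) (y : 'I_m -> E) (j : 'I_n)
    (l : 'I_m) : quasi_basis x -> quasi_basis y -> j = l :> nat ->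
  idem_le (support_idem (x j)) (support_idem (y l)).
Proof.
move=> qx [spy decy _] jl; set i := support_idem (x j).
set i' := support_idem (y l).
have ii : i * i = i by exact: support_idemM.
have i'i' : i' * i' = i' by exact: support_idemM.
apply: idem_le_compl; rewrite mulrC.
apply: (@few_generators_idem_eq0 n m x y j) => //.
- have -> : i * (1 - i') * (i * (1 - i')) =
    i * i * (1 - i' - i' + i' * i') by ring.
  by rewrite ii i'i' subrK.
- by rewrite /idem_le -/i mulrAC ii.
- move=> l' jl'; apply/support_idem_ann; rewrite -(decy l l') -?jl// -/i'.
  have -> : i * (1 - i') * (support_idem (y l') * i') =
    support_idem (y l') * i * (i' - i' * i') by ring.
  by rewrite i'i' subrr mulr0.
Qed.

(** If [m < n], no [y l] has index [m] or more, so that the whole support of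
    [x m] vanishes. *)
Lemma quasi_basis_size_le n m (x : 'I_n -> E) (y : 'I_m -> E) :
  quasi_basis x -> spans y -> (forall j, x j <> 0) -> (n <= m)%N.
Proof.
move=> qx spy x0; rewrite leqNgt; apply/negP => mn.
pose j := Ordinal mn; apply: (x0 j); rewrite -(support_idem_fix (x j)).
suff -> : support_idem (x j) = 0 by rewrite scale0r.
apply: (@few_generators_idem_eq0 _ _ x y j) => //; try exact: support_idemM.
by move=> l; rewrite leqNgt /= ltn_ord.
Qed.

End QuasiBases.

Theorem theorem2p6 (d : measure_display) (Omega : measurableType d)
  (R : realType) (P : probability Omega R) (k : scalar_kind)
  (E : lmodType (L0 P k)) (fgE : finitely_generated E)
  (sepE : partition_separated E) :
  (exists (n : nat) (x : 'I_n -> E), quasi_basis x /\ forall j, x j <> 0) /\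
  (forall (n m : nat) (x : 'I_n -> E) (y : 'I_m -> E),
     quasi_basis x -> quasi_basis y ->
     ((forall j, x j <> 0) -> (forall l, y l <> 0) -> m = n) /\
     (forall (j : 'I_n) (l : 'I_m), j = l :> nat ->
        support_idem (x j) = support_idem (y l))).
Proof.
split=> [|n m x y qx qy].
- have [n [z gen]] := fgE.
  have [t [cas tE]] :=
    exists_cascade (codom z) (L0_relatively_supported sepE).
  exists (size t), (fun j => nth 0 t j); split; last first.
    by move=> j; exact: cascade_neq0.
  apply: (cascade_quasi_basis sepE) => // y; apply: tE; have [a ->] := gen y.
  apply: big_ind => [||j _]; [exact: span0|by move=> *; exact: spanD|].
  by apply: spanZ; apply: span_mem; exact: codom_f.
- split=> [x0 y0|j l jl].
    have [spx _ _] := qx; have [spy _ _] := qy.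
    apply/eqP; rewrite eqn_leq (quasi_basis_size_le sepE qy spx y0).
    exact: (quasi_basis_size_le sepE qx spy x0).
  rewrite -(quasi_basis_support_le sepE qx qy jl) mulrC.
  exact: (quasi_basis_support_le sepE qy qx (esym jl)).
Qed.
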